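(* Let $k$ be a field, let $\mathcal{T}$ be a Hom-finite Krull-Schmidt triangulated $k$-category with suspension functor $\Sigma$, and let $T$ be an object of $\mathcal{T}$. Put $\Gamma=\operatorname{End}_{\mathcal{T}}(T)^{\mathrm{op}}$. Then the functor $\operatorname{Hom}_{\mathcal{T}}(T,-):\mathcal{T}\to\operatorname{mod}\Gamma$ is a quotient functor, i.e. full and dense, if and only if the following two conditions are satisfied: (a) For all right minimal morphisms $T_1\to T_0$ with $T_0,T_1\in\operatorname{add}T$, all distinguished triangles $T_1\to T_0\to X\xrightarrow{h}\Sigma T_1$ completing that morphism satisfy $\operatorname{Hom}_{\mathcal{T}}(T,h)=0$. (b) For all indecomposable $T$-supported objects $X$ of $\mathcal{T}$ there exists a distinguished triangle $T_1\to T_0\to X\xrightarrow{h}\Sigma T_1$ with $T_1,T_0\in\operatorname{add}T$ and $\operatorname{Hom}_{\mathcal{T}}(T,h)=0$.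
   Context: $\operatorname{add}T$ is the full subcategory of direct summands of finite direct sums of copies of $T$. $\operatorname{mod}\Gamma$ is the category of finitely generated (left) $\Gamma$-modules; $\operatorname{Hom}_{\mathcal{T}}(T,X)$ is a $\Gamma$-module via precomposition with endomorphisms of $T$. An object $X$ is called $T$-supported if $\operatorname{Hom}_{\mathcal{T}}(T,X)\neq0$. A morphism $f:A\to B$ is right minimal if every endomorphism $y$ of $A$ with $f\circ y=f$ is an isomorphism. A functor is dense if every object of the target is isomorphic to an object in its image. *)

(* Defs.v *)
From HB Require Import structures.
From mathcomp Require Import all_boot all_algebra.
From mathcomp Require Import boolp.

Set Implicit Arguments.
Unset Strict Implicit.
Unset Printing Implicit Defensive.

Import GRing.Theory.

Declare Scope cat_scope.
Delimit Scope cat_scope with cat.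
Reserved Notation "X ~> Y" (at level 90, right associativity).
Reserved Notation "g \oc f" (at level 40, left associativity).

Local Open Scope ring_scope.
Local Open Scope cat_scope.

Record category := Category {
  obj :> Type;
  hom : obj -> obj -> Type;
  idm : forall X, hom X X;
  comp : forall X Y Z, hom Y Z -> hom X Y -> hom X Z;
  compA : forall X Y Z W (h : hom Z W) (g : hom Y Z) (f : hom X Y),
    comp h (comp g f) = comp (comp h g) f;
  comp1m : forall X Y (f : hom X Y), comp (idm Y) f = f;
  compm1 : forall X Y (f : hom X Y), comp f (idm X) = f
}.
Arguments idm {C} X : rename.
Arguments comp {C X Y Z} g f : rename.

Notation "X ~> Y" := (hom X Y) : cat_scope.
Notation "g \oc f" := (comp g f) : cat_scope.

Definition is_iso (C : category) (X Y : C) (f : X ~> Y) : Prop :=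
  exists g : Y ~> X, g \oc f = idm X /\ f \oc g = idm Y.

Definition isomorphic (C : category) (X Y : C) : Prop :=
  exists f : X ~> Y, is_iso f.

Definition right_minimal (C : category) (A B : C) (f : A ~> B) : Prop :=
  forall y : A ~> A, f \oc y = f -> is_iso y.

Record functor (C D : category) := Functor {
  fobj :> C -> D;
  fmap : forall X Y : C, (X ~> Y) -> (fobj X ~> fobj Y);
  fmap1 : forall X : C, fmap (idm X) = idm (fobj X);
  fmapM : forall (X Y Z : C) (g : Y ~> Z) (f : X ~> Y),
    fmap (g \oc f) = fmap g \oc fmap f
}.
Arguments fmap {C D} F {X Y} f : rename.

Definition full (C D : category) (F : functor C D) : Prop :=
  forall (X Y : C) (g : F X ~> F Y), exists f : X ~> Y, fmap F f = g.

Definition faithful (C D : category) (F : functor C D) : Prop :=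
  forall (X Y : C) (f g : X ~> Y), fmap F f = fmap F g -> f = g.

Definition dense (C D : category) (F : functor C D) : Prop :=
  forall Y : D, exists X : C, isomorphic (F X) Y.

(* Quotient functors in the sense "full and dense" (not localizations). *)
Definition quotient_functor (C D : category) (F : functor C D) : Prop :=
  full F /\ dense F.

Definition equivalence (C D : category) (F : functor C D) : Prop :=
  [/\ full F, faithful F & dense F].

Definition fingen (R : pzRingType) (M : lmodType R) : Prop :=
  exists (n : nat) (b : 'I_n -> M),
    forall x : M, exists c : 'I_n -> R, x = \sum_(i < n) c i *: b i.

(* Split in two records so that the bilinearity axioms below can be written   *)
(* with the canonical module structure on [X ~> Y].                           *)
Record enriched_category (k : fieldType) := EnrichedCategory {
  enriched_cat :> category;
  hom_lmod : forall X Y : enriched_cat, GRing.Lmodule.axioms_ k (X ~> Y)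
}.

HB.instance Definition _ (k : fieldType) (C : enriched_category k) (X Y : C) :=
  @hom_lmod k C X Y.

Record linear_category (k : fieldType) := LinearCategory {
  linear_cat :> enriched_category k;
  comp_linearl : forall (X Y Z : linear_cat) (f : X ~> Y),
    linear (fun g : Y ~> Z => g \oc f);
  comp_linearr : forall (X Y Z : linear_cat) (g : Y ~> Z),
    linear (fun f : X ~> Y => g \oc f)
}.

Definition linear_functor (k : fieldType) (C D : linear_category k)
    (F : functor C D) : Prop :=
  forall X Y : C, linear (fun f : X ~> Y => fmap F f).

Definition hom_finite (k : fieldType) (C : linear_category k) : Prop :=
  forall X Y : C, fingen (X ~> Y : lmodType k).

(* [S] is the direct sum (biproduct) of the finite family [X]; an empty       *)
(* family gives a zero object, and [I := bool] gives binary sums.             *)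
Definition is_dsum (k : fieldType) (C : linear_category k) (I : finType)
    (X : I -> C) (S : C) : Prop :=
  exists (inj : forall i, X i ~> S) (prj : forall i, S ~> X i),
    [/\ forall i, prj i \oc inj i = idm (X i),
        forall i j, i != j -> prj j \oc inj i = 0
      & \sum_i inj i \oc prj i = idm S].

Definition is_dsum2 (k : fieldType) (C : linear_category k) (X Y S : C) : Prop :=
  is_dsum (fun b : bool => if b then X else Y) S.

Definition additive (k : fieldType) (C : linear_category k) : Prop :=
  forall (n : nat) (X : 'I_n -> C), exists S : C, is_dsum X S.

Definition is_zero (k : fieldType) (C : linear_category k) (Z : C) : Prop :=
  forall Y : C, (forall f : Z ~> Y, f = 0) /\ (forall f : Y ~> Z, f = 0).

Definition indecomposable (k : fieldType) (C : linear_category k) (X : C) : Prop :=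
  ~ is_zero X /\ forall Y Z : C, is_dsum2 Y Z X -> is_zero Y \/ is_zero Z.

Definition summand (k : fieldType) (C : linear_category k) (X S : C) : Prop :=
  exists Y : C, is_dsum2 X Y S.

Definition in_add (k : fieldType) (C : linear_category k) (T X : C) : Prop :=
  exists (n : nat) (S : C), is_dsum (fun _ : 'I_n => T) S /\ summand X S.

Definition supported (k : fieldType) (C : linear_category k) (T X : C) : Prop :=
  exists f : T ~> X, f <> 0.

(* The product of the ring [endo X] is composition; [X = 0] is allowed, which *)
(* is why rings here are [pzRingType]s.                                       *)
Definition endo (k : fieldType) (C : linear_category k) (X : C) : Type := X ~> X.

HB.instance Definition _ (k : fieldType) (C : linear_category k) (X : C) :=
  GRing.Zmodule.copy (endo X) (X ~> X).

Lemma compDl (k : fieldType) (C : linear_category k) (X Y Z : C)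
  (f : X ~> Y) (g g' : Y ~> Z) : (g + g') \oc f = g \oc f + g' \oc f.
Proof. by have := comp_linearl f 1 g g'; rewrite !scale1r. Qed.

Lemma compDr (k : fieldType) (C : linear_category k) (X Y Z : C)
  (g : Y ~> Z) (f f' : X ~> Y) : g \oc (f + f') = g \oc f + g \oc f'.
Proof. by have := comp_linearr g 1 f f'; rewrite !scale1r. Qed.

Lemma comp0m (k : fieldType) (C : linear_category k) (X Y Z : C) (f : X ~> Y) :
  (0 : Y ~> Z) \oc f = 0.
Proof. by apply: (addIr (0 \oc f)); rewrite -compDl !add0r. Qed.

Lemma compm0 (k : fieldType) (C : linear_category k) (X Y Z : C) (g : Y ~> Z) :
  g \oc (0 : X ~> Y) = 0.
Proof. by apply: (addIr (g \oc 0)); rewrite -compDr !add0r. Qed.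

Lemma compZr (k : fieldType) (C : linear_category k) (X Y Z : C)
  (g : Y ~> Z) a (f : X ~> Y) : g \oc (a *: f) = a *: (g \oc f).
Proof. by have := comp_linearr g a f 0; rewrite compm0 !addr0. Qed.

Lemma endo_mulDl (k : fieldType) (C : linear_category k) (X : C) :
  left_distributive (fun f g : endo X => f \oc g : endo X) +%R.
Proof. by move=> f g h; apply: compDl. Qed.

Lemma endo_mulDr (k : fieldType) (C : linear_category k) (X : C) :
  right_distributive (fun f g : endo X => f \oc g : endo X) +%R.
Proof. by move=> f g h; apply: compDr. Qed.

HB.instance Definition _ (k : fieldType) (C : linear_category k) (X : C) :=
  GRing.Zmodule_isPzRing.Build (endo X)
    (@compA C X X X X) (@comp1m C X X) (@compm1 C X X)
    (@endo_mulDl k C X) (@endo_mulDr k C X).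

Definition is_unit (R : pzRingType) (x : R) : Prop :=
  exists y : R, x * y = 1 /\ y * x = 1.

(* Noncommutative local rings: the non-units are closed under addition.       *)
Definition local_ring (R : pzRingType) : Prop :=
  1 <> 0 :> R /\
  forall x y : R, ~ is_unit x -> ~ is_unit y -> ~ is_unit (x + y).

Definition krull_schmidt (k : fieldType) (C : linear_category k) : Prop :=
  forall X : C, exists (n : nat) (Y : 'I_n -> C),
    (forall i, local_ring (endo (Y i))) /\ is_dsum Y X.

(* [susp] is only required to be an autoequivalence, not an automorphism.     *)
Record triangulated_category (k : fieldType) := TriangulatedCategory {
  tri_cat :> linear_category k;
  tri_additive : additive tri_cat;
  susp : functor tri_cat tri_cat;
  susp_linear : linear_functor susp;
  susp_equiv : equivalence susp;
  dist : forall X Y Z : tri_cat, (X ~> Y) -> (Y ~> Z) -> (Z ~> susp X) -> Prop;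
  dist_iso : forall (X Y Z X' Y' Z' : tri_cat)
      (f : X ~> Y) (g : Y ~> Z) (h : Z ~> susp X)
      (f' : X' ~> Y') (g' : Y' ~> Z') (h' : Z' ~> susp X')
      (a : X ~> X') (b : Y ~> Y') (c : Z ~> Z'),
    is_iso a -> is_iso b -> is_iso c ->
    b \oc f = f' \oc a -> c \oc g = g' \oc b -> fmap susp a \oc h = h' \oc c ->
    dist f g h -> dist f' g' h';
  dist_id : forall X Z : tri_cat, is_zero Z ->
    dist (idm X) (0 : X ~> Z) (0 : Z ~> susp X);
  dist_cone : forall (X Y : tri_cat) (f : X ~> Y),
    exists (Z : tri_cat) (g : Y ~> Z) (h : Z ~> susp X), dist f g h;
  dist_rot : forall (X Y Z : tri_cat)
      (f : X ~> Y) (g : Y ~> Z) (h : Z ~> susp X),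
    dist f g h <-> dist g h (- fmap susp f);
  dist_fill : forall (X Y Z X' Y' Z' : tri_cat)
      (f : X ~> Y) (g : Y ~> Z) (h : Z ~> susp X)
      (f' : X' ~> Y') (g' : Y' ~> Z') (h' : Z' ~> susp X')
      (a : X ~> X') (b : Y ~> Y'),
    dist f g h -> dist f' g' h' -> b \oc f = f' \oc a ->
    exists c : Z ~> Z',
      c \oc g = g' \oc b /\ fmap susp a \oc h = h' \oc c;
  dist_octahedral : forall (X Y Z U V W : tri_cat)
      (f : X ~> Y) (f1 : Y ~> U) (f2 : U ~> susp X)
      (g : Y ~> Z) (g1 : Z ~> W) (g2 : W ~> susp Y)
      (h1 : Z ~> V) (h2 : V ~> susp X),
    dist f f1 f2 -> dist g g1 g2 -> dist (g \oc f) h1 h2 ->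
    exists (u : U ~> V) (v : V ~> W),
      [/\ dist u v (fmap susp f1 \oc g2),
          u \oc f1 = h1 \oc g, h2 \oc u = f2,
          v \oc h1 = g1 & g2 \oc v = fmap susp f \oc h2]
}.
Arguments dist {k C X Y Z} f g h : rename.
Arguments susp {k C} : rename.

Record fgmod (R : pzRingType) := Fgmod {
  fgmod_lmod :> lmodType R;
  fgmodP : fingen fgmod_lmod
}.

Lemma linear_ext (R : pzRingType) (M N : lmodType R) (f g : {linear M -> N}) :
  f =1 g -> f = g.
Proof.
case: f g => [f [[fA] [fZ]]] [g [[gA] [gZ]]] /= /funext fg; subst g.
by rewrite (Prop_irrelevance gA fA) (Prop_irrelevance gZ fZ).
Qed.

Definition mod_cat (R : pzRingType) : category.
Proof.
refine (@Category (fgmod R) (fun M N => {linear M -> N})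
  (fun M => idfun : {linear M -> M})
  (fun M N P (g : {linear N -> P}) (f : {linear M -> N}) =>
     (g \o f : {linear M -> P})) _ _ _).
- by move=> *; apply: linear_ext.
- by move=> *; apply: linear_ext.
- by move=> *; apply: linear_ext.
Defined.

(* [R^c] is the opposite ring of [R]. *)
Definition Gamma (k : fieldType) (C : linear_category k) (T : C) : pzRingType :=
  (endo T)^c.

(* A copy of [T ~> X] carrying its structure of left [Gamma T]-module, where  *)
(* [a : Gamma T] acts by precomposition.                                      *)
Definition homfrom (k : fieldType) (C : linear_category k) (T X : C) : Type :=
  T ~> X.

HB.instance Definition _ (k : fieldType) (C : linear_category k) (T X : C) :=
  GRing.Zmodule.copy (homfrom T X) (T ~> X).

Definition preact (k : fieldType) (C : linear_category k) (T X : C)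
  (a : Gamma T) (f : homfrom T X) : homfrom T X := f \oc (a : T ~> T).

Lemma preactA (k : fieldType) (C : linear_category k) (T X : C) (a b : Gamma T)
  (f : homfrom T X) : preact a (preact b f) = preact (a * b) f.
Proof. by rewrite /preact -compA. Qed.

Lemma preact1 (k : fieldType) (C : linear_category k) (T X : C) :
  left_id 1 (@preact k C T X).
Proof. by move=> f; apply: compm1. Qed.

Lemma preactDr (k : fieldType) (C : linear_category k) (T X : C) :
  right_distributive (@preact k C T X) +%R.
Proof. by move=> a f g; apply: compDl. Qed.

Lemma preactDl (k : fieldType) (C : linear_category k) (T X : C)
  (f : homfrom T X) : {morph (@preact k C T X)^~ f : a b / a + b}.
Proof. by move=> a b; apply: compDr. Qed.

HB.instance Definition _ (k : fieldType) (C : linear_category k) (T X : C) :=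
  GRing.Zmodule_isLmodule.Build (Gamma T) (homfrom T X)
    (@preactA k C T X) (@preact1 k C T X) (@preactDr k C T X)
    (@preactDl k C T X).

Lemma homfrom_fingen (k : fieldType) (C : linear_category k)
  (hf : hom_finite C) (T X : C) : fingen (homfrom T X : lmodType (Gamma T)).
Proof.
have [n [b bP]] := hf T X; exists n, b => f; have [c ->] := bP f.
exists (fun i => c i *: idm T); apply: eq_bigr => i _.
by rewrite /GRing.scale /= /preact compZr compm1.
Qed.

Definition homfrom_mod (k : fieldType) (C : linear_category k)
  (hf : hom_finite C) (T X : C) : mod_cat (Gamma T) :=
  Fgmod (@homfrom_fingen k C hf T X).

Definition postcomp (k : fieldType) (C : linear_category k) (T X Y : C)
  (h : X ~> Y) (f : homfrom T X) : homfrom T Y := h \oc f.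

Lemma postcomp_linear (k : fieldType) (C : linear_category k) (T X Y : C)
  (h : X ~> Y) : linear (postcomp h : homfrom T X -> homfrom T Y).
Proof.
move=> a f g; rewrite /postcomp compDr; congr (_ + _).
by rewrite /GRing.scale /= /preact compA.
Qed.

HB.instance Definition _ (k : fieldType) (C : linear_category k) (T X Y : C)
    (h : X ~> Y) :=
  GRing.isLinear.Build (Gamma T) (homfrom T X) (homfrom T Y) *:%R
    (postcomp h) (postcomp_linear h).

Definition hom_functor (k : fieldType) (C : linear_category k)
  (hf : hom_finite C) (T : C) : functor C (mod_cat (Gamma T)).
Proof.
refine (@Functor C (mod_cat (Gamma T)) (homfrom_mod hf T)
  (fun X Y h => (postcomp h : {linear homfrom T X -> homfrom T Y})) _ _).
- by move=> X; apply: linear_ext => f; apply: comp1m.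
- by move=> X Y Z g f; apply: linear_ext => u; rewrite /= /postcomp compA.
Defined.

(* Main.v *)
From HB Require Import structures.
From mathcomp Require Import all_boot all_algebra.
From mathcomp Require Import boolp.
Import GRing.Theory.
Require Import Defs.

Set Implicit Arguments.
Unset Strict Implicit.
Unset Printing Implicit Defensive.

Local Open Scope ring_scope.
Local Open Scope cat_scope.

(** Write F for Hom(T, -) and M for a finitely generated module over the
    opposite of the endomorphism algebra of T.  The basic tool is that F behaves
    like a Yoneda embedding on add T: module maps F T0 -> F Y with T0 in add T are induced by
    unique morphisms T0 -> Y ([add_hom_lift], [add_hom_eq0]).  Moreover every M
    has a presentation F T1 -> F T0 -> M -> 0 induced by a morphism f : T1 -> T0
    of add T which is right minimal ([right_minimal_presentation]); kernels are
    finitely generated because morphism spaces are finite dimensional, and f is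
    made right minimal by discarding terms of a Krull-Schmidt decomposition of
    T1 one at a time ([dsum_right_minimal]).

    A triangle T1 -> T0 -> X -h-> Sigma T1 with F h = 0 gives a presentation
    F T1 -> F T0 -> F X -> 0.  This settles one direction.  Condition (b)
    provides such a presentation of F X for each indecomposable X with F X
    nonzero, and a module map F X -> F Y then comes from a map T0 -> Y killed by
    T1, which extends over the cone X; as every object is a finite sum of
    indecomposables, F is full.  If f presents M as above, (a) implies that F of
    the cone of f is isomorphic to M: so F is dense.

    Suppose conversely that F is full and dense, and let X be the cone of a
    right minimal f, with g : T0 -> X and h : X -> Sigma T1.  The image M of F g
    is realized as F X' by density, and fullness turns the maps
    F T0 -> M -> F X into morphisms T0 -> X' -> X composing to g.  The first
    one extends to c : X -> X'; with r : X' -> X the second, the endomorphism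
    r c fixes g and h r c is killed by F.  Completing (id, r c) to an
    endomorphism of the triangle yields y with f y = f, which is invertible by
    minimality, and Sigma y h = h r c; hence F h = 0
    ([quotient_connecting_vanishes]), which is (a).  For (b), take the cone X'
    of a right minimal presentation of F X.  By (a), F X' = F X, and fullness
    together with locality of End X makes X a retract of X'.  The complementary
    idempotent is killed by F, hence factors through h; it induces an idempotent
    of T1 killed by f, which minimality forces to vanish.  So X is isomorphic to
    X' ([minimal_cone_retraction_iso]). *)

(** * Linear algebra *)

(** Universal property of the quotient of [P] by the kernel of [p], stated for
    any surjection [p] so that no quotient module has to be constructed. *)
Lemma linear_factor (R : pzRingType) (P M N : lmodType R)
    (p : {linear P -> M}) (q : {linear P -> N}) :
  (forall m, exists x, p x = m) -> (forall x, p x = 0 -> q x = 0) ->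
  exists t : {linear M -> N}, forall x, t (p x) = q x.
Proof.
move=> psurj kerP; pose s m := projT1 (cid (psurj m)).
have sK m : p (s m) = m by rewrite /s; case: cid.
have qE x y : p x = p y -> q x = q y.
  move=> pxy; apply/eqP; rewrite -subr_eq0 -linearB; apply/eqP/kerP.
  by rewrite linearB pxy subrr.
have lin : linear (q \o s).
  by move=> a x y /=; rewrite -linearP; apply: qE; rewrite linearP !sK.
pose t : {linear M -> N} :=
  HB.pack (q \o s) (GRing.isLinear.Build _ _ _ _ _ lin).
by exists t => x; apply: qE; rewrite sK.
Qed.

Lemma same_kernel_iso (R : pzRingType) (P : lmodType R) (M N : mod_cat R)
    (p : {linear P -> (M : fgmod R)}) (q : {linear P -> (N : fgmod R)}) :
  (forall m, exists x, p x = m) -> (forall n, exists x, q x = n) ->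
  (forall x, p x = 0 <-> q x = 0) -> isomorphic M N.
Proof.
move=> psurj qsurj ker.
have [t tE] := linear_factor psurj (fun x => (ker x).1).
have [u uE] := linear_factor qsurj (fun x => (ker x).2).
exists t, u; split; apply: linear_ext => y /=.
  by have [x <-] := psurj y; rewrite tE uE.
by have [x <-] := qsurj y; rewrite uE tE.
Qed.

Lemma iso_bij (R : pzRingType) (M N : mod_cat R) :
  isomorphic M N -> exists (t : M ~> N) (u : N ~> M),
  (forall x, (u : {linear _ -> _}) ((t : {linear _ -> _}) x) = x) /\
  (forall x, (t : {linear _ -> _}) ((u : {linear _ -> _}) x) = x).
Proof.
move=> [t [u [ut tu]]]; exists t, u; split=> x.
  by move/(congr1 (fun v : {linear _ -> _} => v x)): ut.
by move/(congr1 (fun v : {linear _ -> _} => v x)): tu.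
Qed.

Definition lin_image (R : pzRingType) (P N : lmodType R) (p : {linear P -> N}) :
  {pred N} := fun y => `[< exists x, p x = y >].

Lemma lin_image_closed (R : pzRingType) (P N : lmodType R)
  (p : {linear P -> N}) : submod_closed (lin_image p).
Proof.
split; first by apply/asboolP; exists 0; rewrite linear0.
move=> a _ _ /asboolP[x <-] /asboolP[y <-].
by apply/asboolP; exists (a *: x + y); rewrite linearP.
Qed.

HB.instance Definition _ (R : pzRingType) (P N : lmodType R)
    (p : {linear P -> N}) :=
  GRing.isSubmodClosed.Build R N (lin_image p) (lin_image_closed p).

Record image_mod (R : pzRingType) (P N : lmodType R) (p : {linear P -> N}) :=
  ImageMod { image_val : N; _ : image_val \in lin_image p }.

HB.instance Definition _ (R : pzRingType) (P N : lmodType R)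
  (p : {linear P -> N}) := [isSub for @image_val R P N p].
HB.instance Definition _ (R : pzRingType) (P N : lmodType R)
  (p : {linear P -> N}) := [Choice of image_mod p by <:].
HB.instance Definition _ (R : pzRingType) (P N : lmodType R)
  (p : {linear P -> N}) := [SubChoice_isSubLmodule of image_mod p by <:].

(** For a triangle T1 -> T0 -> X, the cokernel of Hom(T, T1) -> Hom(T, T0) is
    needed as a module; by exactness it is the image of
    Hom(T, T0) -> Hom(T, X), and an image is easier to build than a quotient. *)
Lemma fg_image (R : pzRingType) (P N : lmodType R) (p : {linear P -> N}) :
  fingen P -> exists (M : fgmod R) (q : {linear P -> M}) (i : {linear M -> N}),
  [/\ forall m, exists x, q x = m, injective i & forall x, i (q x) = p x].
Proof.
move=> [n [b bP]].
pose i : {linear image_mod p -> N} := \val.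
have im x : p x \in lin_image p by apply/asboolP; exists x.
pose q0 x : image_mod p := ImageMod (im x).
have lin : linear q0.
  move=> a x y; apply: val_inj; rewrite [LHS]/= -[RHS]/(i _).
  by rewrite !linearP.
pose q : {linear P -> image_mod p} :=
  HB.pack q0 (GRing.isLinear.Build _ _ _ _ _ lin).
have qsurj m : exists x, q x = m.
  by case: m => m mim; have /asboolP[x xE] := mim; exists x; apply: val_inj.
have fgM : fingen (image_mod p : lmodType R).
  exists n, (q \o b) => m; have [x <-] := qsurj m.
  have [c ->] := bP x; exists c; rewrite linear_sum.
  by apply: eq_bigr => j _; rewrite linearZ.
by exists (Fgmod fgM), q, i; split=> //; apply: val_inj.
Qed.

(** This replaces noetherianity of the endomorphism algebra: a submodule of
    Hom(T, T0) is in particular a subspace, so it is generated by finitely many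
    elements already over [k].  The subspace is found as the row space of a
    matrix of maximal rank among those whose rows give elements of [K]. *)
Lemma subspace_fingen (k : fieldType) (V : lmodType k) (K : V -> Prop) :
  fingen V -> K 0 -> (forall a x y, K x -> K y -> K (a *: x + y)) ->
  exists (m : nat) (c : 'I_m -> V), (forall i, K (c i)) /\
    forall x, K x -> exists a : 'I_m -> k, x = \sum_i a i *: c i.
Proof.
move=> [n [b bP]] K0 KP.
pose r (v : 'rV[k]_n) : V := \sum_i v 0 i *: b i.
have rP a v w : r (a *: v + w) = a *: r v + r w.
  rewrite /r scaler_sumr -big_split; apply: eq_bigr => i _ /=.
  by rewrite !mxE scalerDl scalerA.
have r0 : r 0 = 0 by rewrite /r big1 // => i _; rewrite mxE scale0r.
have rsum m (a : 'I_m -> k) (v : 'I_m -> 'rV[k]_n) :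
    r (\sum_i a i *: v i) = \sum_i a i *: r (v i).
  elim: m a v => [|m IH] a v; first by rewrite !big_ord0 r0.
  by rewrite !big_ord_recl rP IH.
(* The row space of A consists of coordinate vectors of elements of K. *)
pose Q (A : 'M[k]_n) := forall v : 'rV_n, (v <= A)%MS -> K (r v).
pose P (d : nat) := `[< exists A, Q A /\ \rank A = d >].
have exP : exists d, P d.
  exists 0%N; apply/asboolP; exists 0; split; last exact: mxrank0.
  by move=> v; rewrite submx0 => /eqP ->; rewrite r0.
have leP d : P d -> (d <= n)%N.
  by move=> /asboolP[A [_ <-]]; apply: rank_leq_row.
have [d /asboolP[A [QA rkA]] dmax] := ex_maxnP exP leP.
exists n, (fun i => r (row i A)); split=> [i|x Kx].
  by apply: QA; apply: row_sub.
have [v xE] : exists v, x = r v.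
  have [c ->] := bP x; exists (\row_i c i).
  by apply: eq_bigr => i _; rewrite mxE.
have QAv : Q (A + v)%MS.
  move=> w /sub_addsmxP[[u1 u2] /= ->].
  rewrite -[u1 *m A]scale1r rP; apply: (KP); first exact/QA/submxMl.
  have -> : u2 *m v = u2 0 0 *: v + 0.
    by rewrite addr0 -mul_scalar_mx -mx11_scalar.
  by rewrite rP r0; apply: KP => //; rewrite -xE.
have /submxP[D vE] : (v <= A)%MS.
  apply: submx_trans (addsmxSr A v) _.
  rewrite -(mxrank_leqif_sup (addsmxSl A v)) eqn_leq.
  rewrite mxrankS ?addsmxSl //= rkA; apply: dmax.
  by apply/asboolP; exists (A + v)%MS.
exists (fun i => D 0 i).
by rewrite xE vE mulmx_sum_row rsum.
Qed.

(** * Linear categories *)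

Lemma comp_suml (k : fieldType) (C : linear_category k) (X Y Z : C) n
    (g : 'I_n -> Y ~> Z) (f : X ~> Y) :
  (\sum_i g i) \oc f = \sum_i (g i \oc f).
Proof.
elim: n g => [|n IH] g; first by rewrite !big_ord0 comp0m.
by rewrite !big_ord_recl compDl IH.
Qed.

Lemma comp_sumr (k : fieldType) (C : linear_category k) (X Y Z : C) n
    (g : Y ~> Z) (f : 'I_n -> X ~> Y) :
  g \oc (\sum_i f i) = \sum_i (g \oc f i).
Proof.
elim: n f => [|n IH] f; first by rewrite !big_ord0 compm0.
by rewrite !big_ord_recl compDr IH.
Qed.

Lemma compNl (k : fieldType) (C : linear_category k) (X Y Z : C)
    (g : Y ~> Z) (f : X ~> Y) : (- g) \oc f = - (g \oc f).
Proof. by apply/eqP; rewrite -addr_eq0 -compDl addNr comp0m. Qed.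

Lemma compNr (k : fieldType) (C : linear_category k) (X Y Z : C)
    (g : Y ~> Z) (f : X ~> Y) : g \oc (- f) = - (g \oc f).
Proof. by apply/eqP; rewrite -addr_eq0 -compDr addNr compm0. Qed.

Lemma compBl (k : fieldType) (C : linear_category k) (X Y Z : C)
    (g g' : Y ~> Z) (f : X ~> Y) : (g - g') \oc f = g \oc f - g' \oc f.
Proof. by rewrite compDl compNl. Qed.

Lemma compBr (k : fieldType) (C : linear_category k) (X Y Z : C)
    (g : Y ~> Z) (f f' : X ~> Y) : g \oc (f - f') = g \oc f - g \oc f'.
Proof. by rewrite compDr compNr. Qed.

Lemma is_zero_idm (k : fieldType) (C : linear_category k) (Z : C) :
  is_zero Z <-> idm Z = 0.
Proof.
split=> [zZ|id0 Y]; first exact: (zZ Z).1.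
by split=> f; [rewrite -[f]compm1 id0 compm0|rewrite -[f]comp1m id0 comp0m].
Qed.

Definition dsum_maps (k : fieldType) (C : linear_category k) (I : finType)
    (X : I -> C) (S : C) (inj : forall i, X i ~> S) (prj : forall i, S ~> X i) :=
  [/\ forall i, prj i \oc inj i = idm (X i),
      forall i j, i != j -> prj j \oc inj i = 0
    & \sum_i inj i \oc prj i = idm S].

(** Binary sums are families indexed by [bool]; this form avoids the dependent
    types of such families. *)
Lemma dsum2P (k : fieldType) (C : linear_category k) (X Y S : C) :
  is_dsum2 X Y S <->
  exists (i1 : X ~> S) (i2 : Y ~> S) (p1 : S ~> X) (p2 : S ~> Y),
    [/\ p1 \oc i1 = idm X, p2 \oc i2 = idm Y, p1 \oc i2 = 0, p2 \oc i1 = 0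
      & i1 \oc p1 + i2 \oc p2 = idm S].
Proof.
split=> [[inj [prj [e1 e2 e3]]]|[i1 [i2 [p1 [p2 [e1 e2 e3 e4 e5]]]]]].
  exists (inj true), (inj false), (prj true), (prj false).
  split; [exact: (e1 true)|exact: (e1 false)| | |by rewrite -e3 big_bool].
    exact: (e2 false true).
  exact: (e2 true false).
pose XY b := if b then X else Y.
pose inj b : XY b ~> S := if b return XY b ~> S then i1 else i2.
pose prj b : S ~> XY b := if b return S ~> XY b then p1 else p2.
by exists inj, prj; split; [case|case; case|rewrite big_bool].
Qed.

Lemma additive2 (k : fieldType) (C : linear_category k) (X Y : C) :
  additive C -> exists S, is_dsum2 X Y S.
Proof.
move=> addC; have [S [inj [prj [e1 e2 e3]]]] :=
  addC 2%N (fun i => nth X [:: X; Y] i).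
exists S; apply/dsum2P.
pose j1 : 'I_2 := lift ord0 ord0.
exists (inj ord0), (inj j1), (prj ord0), (prj j1); split.
- exact: (e1 ord0).
- exact: (e1 j1).
- exact: (e2 j1 ord0).
- exact: (e2 ord0 j1).
by rewrite -e3 big_ord_recl big_ord1.
Qed.

Lemma additive_zero (k : fieldType) (C : linear_category k) :
  additive C -> exists Z : C, is_zero Z.
Proof.
move=> addC; have [Z [inj [prj [_ _ e]]]] :=
  addC 0%N (fun i => False_rect _ (notF (ltn_ord i))).
by exists Z; apply/is_zero_idm; rewrite -e big_ord0.
Qed.

Lemma summand_refl (k : fieldType) (C : linear_category k) (X : C) :
  additive C -> summand X X.
Proof.
move=> /additive_zero[Z zZ]; exists Z; apply/dsum2P.
exists (idm X), 0, (idm X), 0; split; rewrite ?comp0m ?compm0 ?comp1m ?addr0 //.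
by apply/esym/is_zero_idm.
Qed.

Lemma summand_trans (k : fieldType) (C : linear_category k) (X Y Z : C) :
  additive C -> summand X Y -> summand Y Z -> summand X Z.
Proof.
move=> addC [P /dsum2P[i1 [i2 [p1 [p2 [e1 e2 e3 e4 e5]]]]]].
move=> [Q /dsum2P[j1 [j2 [q1 [q2 [d1 d2 d3 d4 d5]]]]]].
have [S /dsum2P[k1 [k2 [r1 [r2 [c1 c2 c3 c4 c5]]]]]] := additive2 P Q addC.
exists S; apply/dsum2P.
exists (j1 \oc i1), (j1 \oc i2 \oc r1 + j2 \oc r2), (p1 \oc q1),
  (k1 \oc p2 \oc q1 + k2 \oc q2).
have K1 W (h : W ~> Y) : q1 \oc (j1 \oc h) = h by rewrite compA d1 comp1m.
have K2 W (h : W ~> Q) : q2 \oc (j2 \oc h) = h by rewrite compA d2 comp1m.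
have K3 W (h : W ~> Q) : q1 \oc (j2 \oc h) = 0 by rewrite compA d3 comp0m.
have K4 W (h : W ~> Y) : q2 \oc (j1 \oc h) = 0 by rewrite compA d4 comp0m.
have L2 W (h : W ~> P) : p2 \oc (i2 \oc h) = h by rewrite compA e2 comp1m.
have L3 W (h : W ~> P) : p1 \oc (i2 \oc h) = 0 by rewrite compA e3 comp0m.
have M1 W (h : W ~> P) : r1 \oc (k1 \oc h) = h by rewrite compA c1 comp1m.
have M2 W (h : W ~> Q) : r2 \oc (k2 \oc h) = h by rewrite compA c2 comp1m.
have M3 W (h : W ~> Q) : r1 \oc (k2 \oc h) = 0 by rewrite compA c3 comp0m.
have M4 W (h : W ~> P) : r2 \oc (k1 \oc h) = 0 by rewrite compA c4 comp0m.
split.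
- by rewrite -!compA K1.
- by rewrite !compDl !compDr -!compA K1 K2 K3 K4 L2 !compm0 addr0 add0r.
- by rewrite !compDr -!compA K1 K3 L3 compm0 addr0.
- by rewrite !compDl -!compA K1 K4 e4 !compm0 addr0.
rewrite !compDl !compDr -!compA M1 M2 M3 M4 !compm0 addr0 add0r addrA -d5.
congr (_ + _); rewrite -!compDr; congr (_ \oc _).
by rewrite !compA -compDl e5 comp1m.
Qed.

Lemma dsum_lift (k : fieldType) (C : linear_category k) n (Y : 'I_n.+1 -> C)
    (S : C) (inj : forall i, Y i ~> S) (prj : forall i, S ~> Y i) j :
  additive C -> dsum_maps inj prj ->
  exists (S' : C) (i' : S' ~> S) (p' : S ~> S'),
    [/\ is_dsum (fun i => Y (lift j i)) S', p' \oc i' = idm S',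
        prj j \oc i' = 0, p' \oc inj j = 0 & inj j \oc prj j + i' \oc p' = idm S].
Proof.
move=> addC [e1 e2 e3].
have [S' [inj' [prj' [d1 d2 d3]]]] := addC n (fun i => Y (lift j i)).
exists S', (\sum_i inj (lift j i) \oc prj' i), (\sum_i inj' i \oc prj (lift j i)).
split; first by exists inj', prj'.
- rewrite comp_suml -d3; apply: eq_bigr => i _; rewrite comp_sumr (bigD1 i) //=.
  rewrite big1 ?addr0 => [|l li].
    by rewrite -!compA [prj _ \oc _]compA e1 comp1m.
  by rewrite -!compA [prj _ \oc _]compA e2 ?(inj_eq lift_inj) // comp0m compm0.
- rewrite comp_sumr big1 // => i _.
  by rewrite compA e2 ?comp0m // eq_sym neq_lift.
- rewrite comp_suml big1 // => i _.
  by rewrite -compA e2 ?compm0 // neq_lift.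
rewrite -e3 (bigD1_ord j) //=; congr (_ + _).
rewrite comp_suml; apply: eq_bigr => i _; rewrite comp_sumr (bigD1 i) //=.
rewrite big1 ?addr0 => [|l li].
  by rewrite -!compA [prj' _ \oc _]compA d1 comp1m.
by rewrite -!compA [prj' _ \oc _]compA d2 ?comp0m ?compm0.
Qed.

(** * Objects with local endomorphism rings *)

Lemma local_unitB (R : pzRingType) (x : R) :
  local_ring R -> ~ is_unit x -> is_unit (1 - x).
Proof.
move=> [_ loc] xN; apply: contrapT => x1N; apply: (loc _ _ xN x1N).
by exists 1; rewrite addrC subrK !mulr1.
Qed.

Lemma local_indecomposable (k : fieldType) (C : linear_category k) (X : C) :
  local_ring (endo X) -> indecomposable X.
Proof.
move=> loc; split=> [/is_zero_idm X0|Y Z]; first by case: loc => + _; apply.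
case/dsum2P=> [i1 [i2 [p1 [p2 [e1 e2 e3 e4 e5]]]]].
have [[g [_ ge]]|eN] := pselect (is_unit (i1 \oc p1 : endo X)).
  right; apply/is_zero_idm.
  have : (g : X ~> X) \oc (i1 \oc p1) \oc i2 = i2.
    by rewrite (ge : (g : X ~> X) \oc _ = idm X) comp1m.
  by rewrite -!compA e3 !compm0 -e2 => <-; rewrite compm0.
have [g [_ ge]] := local_unitB loc eN.
left; apply/is_zero_idm.
have : (g : X ~> X) \oc (idm X - i1 \oc p1) \oc i1 = i1.
  by rewrite (ge : (g : X ~> X) \oc _ = idm X) comp1m.
rewrite -!compA compBl -compA e1 comp1m compm1 subrr compm0 -e1 => <-.
by rewrite compm0.
Qed.

(** Peeling off one term of a Krull-Schmidt decomposition, the complement must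
    vanish since the term does not: the decomposition has exactly one term, and
    conjugation with its injection identifies the endomorphism rings. *)
Lemma dsum_local_indecomposable (k : fieldType) (C : linear_category k) n
    (Y : 'I_n -> C) (X : C) :
  additive C -> (forall i, local_ring (endo (Y i))) -> is_dsum Y X ->
  indecomposable X -> local_ring (endo X).
Proof.
move=> addC; case: n Y => [|n] Y loc [inj [prj dsX]] [XN0 Xdec].
  by case: XN0; apply/is_zero_idm; case: dsX => _ _; rewrite big_ord0.
have [S [i' [p' [_ e1 e2 e3 e4]]]] := dsum_lift ord0 addC dsX.
have pi1 : prj ord0 \oc inj ord0 = idm (Y ord0) by case: dsX.
have S0 : is_zero S.
  have /Xdec[|//] : is_dsum2 (Y ord0) S X.
    by apply/dsum2P; exists (inj ord0), i', (prj ord0), p'.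
  by move/is_zero_idm; case: (loc ord0).
have ip1 : inj ord0 \oc prj ord0 = idm X.
  by rewrite -e4 ((S0 X).1 i') comp0m addr0.
have [Y1 YD] := loc ord0.
pose c (x : endo X) : endo (Y ord0) := prj ord0 \oc (x : X ~> X) \oc inj ord0.
have cM x y : c (x * y) = c x * c y.
  rewrite /c /GRing.mul /= !compA; congr (_ \oc _).
  by rewrite -!compA [inj _ \oc (_ \oc _)]compA ip1 comp1m.
have c1 : c 1 = 1 by rewrite /c [1 : endo X]/GRing.one /= compm1 pi1.
have cD x y : c (x + y) = c x + c y by rewrite /c compDr compDl.
have c0 : c 0 = 0 by rewrite /c compm0 comp0m.
have unitc x : is_unit (c x) <-> is_unit x.
  split=> [[y [xy yx]]|[y [xy yx]]].
    2: by exists (c y); rewrite -!cM xy yx c1.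
  pose z : endo X := inj ord0 \oc (y : Y ord0 ~> Y ord0) \oc prj ord0.
  have cz : c z = y.
    by rewrite /c /z !compA pi1 comp1m -compA pi1 compm1.
  have cI u v : c u = c v -> u = v.
    move/(congr1 (fun w : endo (Y ord0) =>
      inj ord0 \oc (w : Y ord0 ~> Y ord0) \oc prj ord0)).
    by rewrite /c !compA ip1 !comp1m -!compA ip1 !compm1.
  by exists z; split; apply: cI; rewrite cM cz c1.
split=> [e|x y]; first by apply: Y1; rewrite -c1 e c0.
by rewrite -!unitc cD; apply: YD.
Qed.

(** The hypothesis says that [u] is in the radical, so this is the statement
    that 1 - u is invertible for u in the radical, obtained by Gaussian
    elimination: along the indices of the decomposition, the pivots are of the
    form 1 - (non-unit), hence are units because the endomorphism rings are
    local. *)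
Lemma radical_right_invertible (k : fieldType) (C : linear_category k) n
    (Y : 'I_n -> C) (S : C) (inj : forall i, Y i ~> S)
    (prj : forall i, S ~> Y i) (u : S ~> S) :
  (forall i, local_ring (endo (Y i))) -> dsum_maps inj prj ->
  (forall i (w : Y i ~> S), ~ is_unit (prj i \oc (u \oc w) : endo (Y i))) ->
  exists z, (idm S - u) \oc z = idm S.
Proof.
move=> loc [e1 e2 e3] uN; pose y := idm S - u.
(* Every x is solved for modulo the components outside s, with a solution z
   supported on s; the support condition gives pivots of the form
   1 - prj i (u w). *)
have P (s : seq 'I_n) X (x : X ~> S) : exists z : X ~> S,
    (forall i, i \notin s -> prj i \oc z = 0) /\
    (forall i, i \in s -> prj i \oc (x - y \oc z) = 0).
  elim: s X x => [|i s IH] X x; first by exists 0; split=> // j _; rewrite compm0.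
  have [z1 [z1N z1s]] := IH _ x.
  have [is_|isN] := boolP (i \in s).
    exists z1; split=> j; rewrite in_cons; last first.
      by case/predU1P=> [->|]; apply: z1s.
    by rewrite negb_or => /andP[_]; apply: z1N.
  have [zi [ziN zis]] := IH _ (y \oc inj i).
  pose w := inj i - zi.
  have yw j : j \in s -> prj j \oc (y \oc w) = 0.
    by move=> js; rewrite -(zis _ js) /w compBr.
  have prjw : prj i \oc w = idm (Y i) by rewrite /w compBr e1 ziN // subr0.
  (* The pivot: y w has component prj i (y w) at i and none at s. *)
  have [t' [yt _]] := local_unitB (loc i) (@uN i w).
  have ywE : prj i \oc (y \oc w) = idm (Y i) - prj i \oc (u \oc w).
    by rewrite /y compBl comp1m compBr prjw.
  exists (z1 + w \oc t' \oc (prj i \oc (x - y \oc z1))); split=> j.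
    rewrite in_cons negb_or => /andP[ji js].
    have prjwj : prj j \oc w = 0.
      by rewrite /w compBr e2 1?eq_sym // ziN // subr0.
    by rewrite compDr z1N // add0r !compA prjwj !comp0m.
  have -> : x - y \oc (z1 + w \oc t' \oc (prj i \oc (x - y \oc z1))) =
      (x - y \oc z1) - y \oc w \oc t' \oc (prj i \oc (x - y \oc z1)).
    by rewrite compDr opprD addrA !compA.
  rewrite in_cons => /predU1P[->|js].
    rewrite compBr; apply/eqP; rewrite subr_eq0; apply/eqP.
    by rewrite !compA -[prj i \oc y \oc w]compA ywE (yt : _ \oc _ = idm _) comp1m.
  by rewrite compBr z1s // !compA -[prj j \oc y \oc w]compA yw // !comp0m subr0.
have [z [_ zE]] := P (enum 'I_n) S (idm S).
exists z; apply/esym/eqP; rewrite -subr_eq0; apply/eqP.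
rewrite -[LHS]comp1m -{1}e3 comp_suml big1 // => i _.
by rewrite -compA -/y zE ?compm0 // mem_enum.
Qed.

(** A right inverse z of 1 - u has the form 1 + u z, and - u z satisfies the
    same hypothesis as u, so z is right invertible too. *)
Lemma radical_iso (k : fieldType) (C : linear_category k) n
    (Y : 'I_n -> C) (S : C) (inj : forall i, Y i ~> S)
    (prj : forall i, S ~> Y i) (u : S ~> S) :
  (forall i, local_ring (endo (Y i))) -> dsum_maps inj prj ->
  (forall i (w : Y i ~> S), ~ is_unit (prj i \oc (u \oc w) : endo (Y i))) ->
  is_iso (idm S - u).
Proof.
move=> loc dsS uN; have [z yz] := radical_right_invertible loc dsS uN.
have zE : z = idm S - (- (u \oc z)).
  by rewrite opprK -yz compBl comp1m subrK.
have [|x zx] := @radical_right_invertible _ _ _ _ _ _ _ (- (u \oc z)) loc dsS.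
  by move=> i w; rewrite compNl -compA -compNr; apply: uN.
exists z; split=> //; rewrite -zE in zx.
have -> // : idm S - u = x.
by rewrite -[LHS]compm1 -{2}zx compA yz comp1m.
Qed.

(** If f is not right minimal, some f y = f with y not invertible; 1 - y is then
    not in the radical, which gives a term [Y j] and w : Y j -> S with
    prj j w = 1 and f w = 0.  After the change of coordinates 1 - w prj j the
    term [Y j] becomes redundant, and induction applies to the remaining ones.
    Mutual factorization is what guarantees that f' and f have the same image
    under Hom(T, -). *)
Lemma dsum_right_minimal (k : fieldType) (C : linear_category k) n
    (Y : 'I_n -> C) (S T0 : C) (f : S ~> T0) :
  additive C -> (forall i, local_ring (endo (Y i))) -> is_dsum Y S ->
  exists (S' : C) (f' : S' ~> T0) (a : S ~> S') (b : S' ~> S),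
    [/\ summand S' S, right_minimal f', f = f' \oc a & f' = f \oc b].
Proof.
move=> addC; elim: n Y S f => [|n IH] Y S f loc [inj [prj dsS]].
  have [_ _] := dsS; rewrite big_ord0 => /esym/is_zero_idm S0.
  exists S, f, (idm S), (idm S); split; rewrite ?compm1 //.
    exact: summand_refl.
  by move=> y _; exists (idm S); split; rewrite ?compm1 ?comp1m;
     apply: etrans ((S0 _).1 _) (esym ((S0 _).1 _)).
have [[j [w [prjw fw]]]|noW] := pselect (exists j (w : Y j ~> S),
    prj j \oc w = idm (Y j) /\ f \oc w = 0).
  have [S1 [i1 [p1 [ds1 e1 e2 e3 e4]]]] := dsum_lift j addC dsS.
  have [S' [f' [a [b [sumS' minf' fi1 f'E]]]]] :=
    IH _ S1 (f \oc i1) (fun i => loc (lift j i)) ds1.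
  exists S', f', (a \oc p1 \oc (idm S - w \oc prj j)), (i1 \oc b); split=> //.
  - apply: summand_trans addC sumS' _; exists (Y j); apply/dsum2P.
    exists i1, (inj j), p1, (prj j); split=> //; last by rewrite addrC.
    by case: dsS.
  - rewrite !compA -fi1 -[f \oc i1 \oc p1]compA.
    have -> : i1 \oc p1 = idm S - inj j \oc prj j by rewrite -e4 addrC addKr.
    rewrite -compA.
    have -> : (idm S - inj j \oc prj j) \oc (idm S - w \oc prj j) =
        idm S - w \oc prj j.
      rewrite compBl comp1m compBr compm1 -[inj j \oc prj j \oc _]compA.
      by rewrite [prj j \oc (_ \oc _)]compA prjw comp1m subrr subr0.
    by rewrite compBr compm1 compA fw comp0m subr0.
  by rewrite compA.
exists S, f, (idm S), (idm S); split; rewrite ?compm1 //.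
  exact: summand_refl.
move=> y fy; rewrite -[y](subKr (idm S)); apply: radical_iso loc dsS _.
move=> i w [v [uv _]]; apply: noW; exists i, ((idm S - y) \oc w \oc v).
split; first by rewrite -[RHS]uv /GRing.mul /= !compA.
by rewrite !compA compBr compm1 fy subrr !comp0m.
Qed.

(** * Triangles *)

Lemma susp0 (k : fieldType) (C : triangulated_category k) (X Y : C) :
  fmap susp (0 : X ~> Y) = 0.
Proof.
apply: (addIr (fmap susp (0 : X ~> Y))); rewrite add0r.
by have := susp_linear 1 (0 : X ~> Y) 0; rewrite !scale1r addr0.
Qed.

Lemma susp_is_zero (k : fieldType) (C : triangulated_category k) (Z : C) :
  is_zero Z -> is_zero (susp Z).
Proof.
by move=> /is_zero_idm Z0; apply/is_zero_idm; rewrite -fmap1 Z0 susp0.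
Qed.

Lemma dist_comp0 (k : fieldType) (C : triangulated_category k) (X Y Z : C)
    (f : X ~> Y) (g : Y ~> Z) (h : Z ~> susp X) : dist f g h -> g \oc f = 0.
Proof.
move=> d; have [O zO] := additive_zero (@tri_additive k C).
have [|c [<- _]] := dist_fill (a := idm X) (b := f) (dist_id X zO) d.
  by rewrite !compm1.
by rewrite compm0.
Qed.

(** The morphism of triangles to the rotated triangle (g, h, - Sigma f) from the
    rotation of the trivial triangle on W, has its third component between
    suspensions; it is brought back because the suspension is fully faithful. *)
Lemma dist_lift (k : fieldType) (C : triangulated_category k) (X Y Z W : C)
    (f : X ~> Y) (g : Y ~> Z) (h : Z ~> susp X) (x : W ~> Y) :
  dist f g h -> g \oc x = 0 -> exists s, x = f \oc s.
Proof.
move=> /dist_rot d gx0; have [O zO] := additive_zero (@tri_additive k C).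
have /dist_rot d0 := dist_id W zO.
have [|c [_ cE]] := dist_fill (a := x) (b := (0 : O ~> Z)) d0 d.
  by rewrite comp0m gx0.
have [Sfull Sfaith _] := susp_equiv C.
have [s sE] := Sfull _ _ c; exists s; apply: Sfaith.
by move: cE; rewrite compNr compNl fmap1 compm1 => /oppr_inj; rewrite fmapM sE.
Qed.

Lemma dist_extend (k : fieldType) (C : triangulated_category k) (X Y Z W : C)
    (f : X ~> Y) (g : Y ~> Z) (h : Z ~> susp X) (x : Y ~> W) :
  dist f g h -> x \oc f = 0 -> exists s, x = s \oc g.
Proof.
move=> d xf0; have [O zO] := additive_zero (@tri_additive k C).
have d0 : dist (0 : O ~> W) (idm W) 0.
  by apply/dist_rot; rewrite susp0 oppr0; apply/dist_id/susp_is_zero.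
have [|c [cE _]] := dist_fill (a := (0 : X ~> O)) (b := x) d d0.
  by rewrite comp0m xf0.
by exists c; rewrite cE comp1m.
Qed.

(** * The functor represented by an object *)

(** A dual basis of X over T: the Yoneda arguments for T extend to the objects
    of add T through it. *)
Lemma in_add_retract (k : fieldType) (C : linear_category k) (T X : C) :
  in_add T X -> exists (n : nat) (a : 'I_n -> T ~> X) (b : 'I_n -> X ~> T),
    \sum_i a i \oc b i = idm X.
Proof.
move=> [n [S [[inj [prj [_ _ e]]] [Z /dsum2P[i1 [i2 [p1 [p2 [e1 _ _ _ _]]]]]]]]].
exists n, (fun i => p1 \oc inj i), (fun i => prj i \oc i1).
transitivity (p1 \oc (\sum_i inj i \oc prj i) \oc i1).
  by rewrite comp_sumr comp_suml; apply: eq_bigr => i _; rewrite !compA.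
by rewrite e compm1.
Qed.

Lemma add_hom_eq0 (k : fieldType) (C : linear_category k) (T X Y : C)
    (u : X ~> Y) :
  in_add T X -> (forall s : T ~> X, u \oc s = 0) -> u = 0.
Proof.
move=> /in_add_retract[n [a [b e]]] u0.
rewrite -[u]compm1 -e comp_sumr big1 // => i _.
by rewrite compA u0 comp0m.
Qed.

(** With (a, b) the dual basis of X over T, the only candidate is
    u = sum of phi(a i) b i; linearity of phi over the endomorphisms of T is
    what makes it work on every s, since s = sum of a i (b i s). *)
Lemma add_hom_lift (k : fieldType) (C : linear_category k) (T X Y : C)
    (phi : {linear homfrom T X -> homfrom T Y}) :
  in_add T X -> exists u : X ~> Y, forall s : T ~> X, phi s = u \oc s.
Proof.
move=> /in_add_retract[n [a [b e]]].
exists (\sum_i (phi (a i) : T ~> Y) \oc b i) => s.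
have sE : s = \sum_i ((b i \oc s : Gamma T) *: (a i : homfrom T X) : homfrom T X).
  rewrite -[LHS]comp1m -e comp_suml; apply: eq_bigr => i _.
  by rewrite -compA.
rewrite [in LHS]sE linear_sum comp_suml; apply: eq_bigr => i _.
by rewrite linearZ -compA.
Qed.

Lemma in_add_dsum (k : fieldType) (C : linear_category k) (T S : C) n :
  additive C -> is_dsum (fun _ : 'I_n => T) S -> in_add T S.
Proof. by move=> addC ds; exists n, S; split; last exact: summand_refl. Qed.

Lemma in_add_summand (k : fieldType) (C : linear_category k) (T X Y : C) :
  additive C -> summand X Y -> in_add T Y -> in_add T X.
Proof.
move=> addC XY [n [S [dsS YS]]]; exists n, S; split=> //.
exact: summand_trans XY YS.
Qed.

(** Generators of M give a surjection from Hom(T, T^n) onto M, generators of its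
    kernel a morphism from T^m to T^n, and the latter is replaced by its right
    minimal version. *)
Lemma right_minimal_presentation (k : fieldType) (C : linear_category k)
    (hf : hom_finite C) (ks : krull_schmidt C) (T : C) (M : fgmod (Gamma T)) :
  additive C ->
  exists (T1 T0 : C) (f : T1 ~> T0) (p : {linear homfrom T T0 -> M}),
    [/\ in_add T T1, in_add T T0, right_minimal f, forall m, exists s, p s = m
      & forall s : T ~> T0, p s = 0 <-> exists t : T ~> T1, s = f \oc t].
Proof.
move=> addC; have [n [b bP]] := fgmodP M.
have [T0 ds0] := addC n (fun=> T); have addT0 := in_add_dsum addC ds0.
have [inj [prj [e1 e2 _]]] := ds0.
pose p0 (s : homfrom T T0) : M := \sum_i (prj i \oc s : Gamma T) *: b i.
have lin : linear p0.
  move=> a s s'; rewrite /p0 scaler_sumr -big_split; apply: eq_bigr => i _ /=.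
  rewrite scalerA -scalerDl; congr (_ *: _).
  by rewrite compDr compA.
pose p : {linear homfrom T T0 -> M} :=
  HB.pack p0 (GRing.isLinear.Build _ _ _ _ _ lin).
have psurj m : exists s, p s = m.
  have [c ->] := bP m.
  exists (\sum_i inj i \oc (c i : T ~> T)).
  apply: eq_bigr => i _; congr (_ *: _).
  rewrite comp_sumr (bigD1 i) //= big1 ?addr0 => [|j ji].
    by rewrite compA e1 comp1m.
  by rewrite compA e2 // comp0m.
have [||m [c [cK cP]]] := @subspace_fingen k (T ~> T0) (fun s => p s = 0) (hf _ _).
- exact: linear0.
- move=> a s s' ps ps'.
  have -> : a *: s + s' = (a *: idm T : Gamma T) *: (s : homfrom T T0) + s'.
    by congr (_ + _); rewrite /GRing.scale /= /preact compZr compm1.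
  by rewrite linearP ps ps' scaler0 addr0.
have [S dsS] := addC m (fun=> T); have [inj1 [prj1 [d1 d2 _]]] := dsS.
pose f := \sum_i c i \oc prj1 i.
have fP s : p s = 0 <-> exists t : T ~> S, s = f \oc t.
  split=> [/cP[a ->]|[t ->]].
    exists (\sum_i a i *: inj1 i).
    rewrite comp_sumr; apply: eq_bigr => i _; rewrite compZr; congr (a i *: _).
    rewrite comp_suml (bigD1 i) //= big1 ?addr0 => [|j ji].
      by rewrite -compA d1 compm1.
    by rewrite -compA d2 1?eq_sym // compm0.
  rewrite comp_suml [LHS]linear_sum big1 // => i _.
  have -> : c i \oc prj1 i \oc t = (prj1 i \oc t : Gamma T) *: (c i : homfrom T T0).
    by rewrite -compA.
  by rewrite linearZ cK; apply: scaler0.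
have [r [Y [loc dsY]]] := ks S.
have [T1 [f' [a [b' [sumT1 minf' fE f'E]]]]] :=
  dsum_right_minimal f addC loc dsY.
exists T1, T0, f', p; split=> // [|s].
  exact/(in_add_summand addC sumT1)/(in_add_dsum addC dsS).
rewrite fP; split=> [[t ->]|[t ->]].
  by exists (a \oc t); rewrite compA -fE.
by exists (b' \oc t); rewrite compA -f'E.
Qed.

Lemma hom_functor_fullP (k : fieldType) (C : linear_category k)
    (hf : hom_finite C) (T : C) :
  full (hom_functor hf T) <->
  forall (X Y : C) (phi : {linear homfrom T X -> homfrom T Y}),
    exists u : X ~> Y, forall s : T ~> X, phi s = u \oc s.
Proof.
split=> [fullF X Y phi|liftF X Y phi].
  by have [u <-] := fullF X Y phi; exists u.
have [u uE] := liftF X Y phi; exists u.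
by apply: linear_ext => s; rewrite uE.
Qed.

Lemma cone_realizes_cokernel (k : fieldType) (C : triangulated_category k)
    (hf : hom_finite C) (T T1 T0 X : C) (M : mod_cat (Gamma T))
    (f : T1 ~> T0) (g : T0 ~> X) (h : X ~> susp T1)
    (p : {linear homfrom T T0 -> (M : fgmod (Gamma T))}) :
  (forall m, exists s, p s = m) ->
  (forall s : T ~> T0, p s = 0 <-> exists t : T ~> T1, s = f \oc t) ->
  dist f g h -> (forall s : T ~> X, h \oc s = 0) ->
  isomorphic (hom_functor hf T X) M.
Proof.
move=> psurj kerp d h0.
apply: (@same_kernel_iso _ _ (homfrom_mod hf T X) M
  (postcomp g : {linear homfrom T T0 -> homfrom T X}) p) => // [x|s].
  have /dist_rot d' := d.
  by have [s ->] := dist_lift d' (h0 x); exists s.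
rewrite kerp; split=> [/(dist_lift d)//|[t ->]].
by rewrite /= /postcomp compA (dist_comp0 d) comp0m.
Qed.

(** Density is applied to the module im Hom(T, g).  The morphism f is right
    minimal, so the endomorphism of T1 induced by one of X fixing g
    is invertible; choosing the latter with image inside that of g kills h on
    morphisms from T. *)
Lemma quotient_connecting_vanishes (k : fieldType) (C : triangulated_category k)
    (hf : hom_finite C) (T T1 T0 X : C)
    (f : T1 ~> T0) (g : T0 ~> X) (h : X ~> susp T1) :
  quotient_functor (hom_functor hf T) ->
  in_add T T1 -> in_add T T0 -> right_minimal f -> dist f g h ->
  forall s : T ~> X, h \oc s = 0.
Proof.
move=> [/hom_functor_fullP liftF denseF] addT1 addT0 minf d.
have [M [q [i [qsurj iI iq]]]] :=
  fg_image (postcomp g : {linear homfrom T T0 -> homfrom T X})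
           (homfrom_fingen hf T T0).
(* M is the image of Hom(T, g), realized as Hom(T, X'). *)
have [X' /iso_bij[t [t' [tK t'K]]]] := denseF M.
have [g' g'E] := add_hom_lift
  ((t' : {linear M -> homfrom T X'}) \o q
     : {linear homfrom T T0 -> homfrom T X'}) addT0.
have [r rE] := liftF X' X (i \o (t : {linear homfrom T X' -> M})).
have rg' : r \oc g' = g.
  apply/eqP; rewrite -subr_eq0; apply/eqP/(add_hom_eq0 addT0) => s.
  rewrite compBl -compA -g'E -rE /= t'K iq.
  by apply: subrr.
have [c cg] : exists c, g' = c \oc g.
  apply: (dist_extend d); apply: (add_hom_eq0 addT1) => s.
  rewrite -compA -g'E /=.
  have -> : q (f \oc s) = 0.
    apply: iI; rewrite iq linear0 /= /postcomp compA (dist_comp0 d).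
    exact: comp0m.
  exact: linear0.
(* r takes values in the image of g, which h kills. *)
have hrc (x : T ~> X) : h \oc (r \oc (c \oc x)) = 0.
  have -> : r \oc (c \oc x) = i ((t : {linear homfrom T X' -> M}) (c \oc x)).
    by rewrite -rE.
  have [s <-] := qsurj ((t : {linear homfrom T X' -> M}) (c \oc x)).
  rewrite iq /= /postcomp compA; move/dist_rot/dist_comp0: d => ->.
  exact: comp0m.
have d1 := d; move/dist_rot: d1 => d1.
have [|y' [y'E fy']] := dist_fill (a := idm T0) (b := r \oc c) d1 d1.
  by rewrite compm1 -compA -cg rg'.
have [Sfull Sfaith _] := susp_equiv C.
have [y yE] := Sfull _ _ y'.
have [z [zy _]] : is_iso y.
  apply: minf; apply: Sfaith; rewrite fmapM yE.
  by move: fy'; rewrite fmap1 comp1m compNl => /oppr_inj <-.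
move=> s; rewrite -[LHS]comp1m -fmap1 -zy fmapM yE -compA [y' \oc _]compA y'E.
by rewrite -compA -[r \oc c \oc s]compA hrc compm0.
Qed.

(** The triangle T1 -> T0 -> X' cannot have a summand Z of X' on which Hom(T, -)
    vanishes: T0 -> Z would be zero, Z would embed in Sigma T1 as a direct
    summand, and T1 would contain a summand killed by f.  The argument is run
    with the idempotent e of X' instead of its image, so that no idempotent has
    to be split. *)
Lemma minimal_cone_retraction_iso (k : fieldType) (C : triangulated_category k)
    (T T1 T0 X X' : C) (f : T1 ~> T0) (g : T0 ~> X') (h : X' ~> susp T1)
    (u : X ~> X') (v : X' ~> X) :
  in_add T T0 -> right_minimal f -> dist f g h -> v \oc u = idm X ->
  (forall s : T ~> X', u \oc (v \oc s) = s) -> is_iso v.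
Proof.
move=> addT0 minf d vu uvF; pose e := idm X' - u \oc v.
have ee : e \oc e = e.
  rewrite {2}/e compBr compm1 {2}/e compBl comp1m compA -[u \oc v \oc u]compA.
  by rewrite vu compm1 subrr subr0.
have d1 := d; move/dist_rot: d1 => d1.
have [w ewh] : exists w, e = w \oc h.
  apply: (dist_extend d1); apply: (add_hom_eq0 addT0) => s.
  by rewrite /e compBl comp1m compBl -!compA uvF subrr.
have [Sfull Sfaith _] := susp_equiv C.
(* h e w is idempotent, as w h = e; and e = w (h e w) h vanishes with it. *)
have [y yE] := Sfull _ _ (h \oc e \oc w).
have fy0 : f \oc y = 0.
  apply: Sfaith; rewrite susp0 fmapM yE !compA.
  have /eqP := dist_comp0 (iffLR (dist_rot _ _ _) d1).
  by rewrite compNl oppr_eq0 => /eqP ->; rewrite !comp0m.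
have yy : y \oc y = y.
  apply: Sfaith; rewrite fmapM yE -!compA [w \oc (h \oc _)]compA -ewh.
  by rewrite [e \oc (e \oc w)]compA ee [e \oc (e \oc _)]compA ee.
have [z [zy _]] : is_iso (idm T1 - y).
  by apply: minf; rewrite compBr compm1 fy0 subr0.
have y0 : y = 0.
  by rewrite -[y]comp1m -zy -compA compBl comp1m yy subrr compm0.
have e0 : e = 0.
  have -> : e = w \oc (h \oc e \oc w) \oc h.
    by rewrite !compA -ewh ee -compA -ewh ee.
  by rewrite -yE y0 susp0 compm0 comp0m.
by exists u; split=> //; apply/esym/eqP; rewrite -subr_eq0 -/e e0.
Qed.

(** The cone X' of a right minimal presentation of Hom(T, X) satisfies
    Hom(T, X') = Hom(T, X).  The induced endomorphism of X acts as the identity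
    on Hom(T, X), which is nonzero, so 1 minus it is not invertible and it is
    invertible itself, End X being local. *)
Lemma quotient_add_resolution (k : fieldType) (C : triangulated_category k)
    (hf : hom_finite C) (ks : krull_schmidt C) (T X : C) :
  quotient_functor (hom_functor hf T) -> indecomposable X -> supported T X ->
  exists (T1 T0 : C) (f : T1 ~> T0) (g : T0 ~> X) (h : X ~> susp T1),
    [/\ in_add T T1, in_add T T0, dist f g h & forall s : T ~> X, h \oc s = 0].
Proof.
move=> quotF indX [s0 s0N0].
have addC := @tri_additive k C.
have [T1 [T0 [f [p [addT1 addT0 minf psurj kerp]]]]] :=
  right_minimal_presentation hf ks (homfrom_mod hf T X) addC.
have [X' [g [h d]]] := dist_cone f.
have h0 := quotient_connecting_vanishes quotF addT1 addT0 minf d.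
have /iso_bij[t [t' [tK t'K]]] := cone_realizes_cokernel hf psurj kerp d h0.
have [/hom_functor_fullP liftF _] := quotF.
have [v vE] := liftF X' X t; have [u uE] := liftF X X' t'.
have vuF (s : T ~> X) : v \oc u \oc s = s by rewrite -compA -uE -vE t'K.
have uvF (s : T ~> X') : u \oc (v \oc s) = s by rewrite -vE -uE tK.
have locX : local_ring (endo X).
  have [n [Y [locY dsY]]] := ks X.
  exact: dsum_local_indecomposable addC locY dsY indX.
have [[w [vuw _]]|vuN] := pselect (is_unit (v \oc u : endo X)); last first.
  have [w [_ wE]] := local_unitB locX vuN; case: s0N0.
  have : (w : X ~> X) \oc (idm X - v \oc u) \oc s0 = s0.
    by rewrite (wE : (w : X ~> X) \oc _ = idm X) comp1m.
  by rewrite -compA compBl comp1m vuF subrr compm0.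
have {}vuw : v \oc (u \oc (w : X ~> X)) = idm X by rewrite compA.
have wF (s : T ~> X) : (w : X ~> X) \oc s = s.
  by rewrite -[LHS]vuF -!compA [u \oc (_ \oc s)]compA compA vuw comp1m.
have uwvF (s : T ~> X') : (u \oc (w : X ~> X)) \oc (v \oc s) = s.
  by rewrite -compA wF uvF.
have [u' [u'v vu']] := minimal_cone_retraction_iso addT0 minf d vuw uwvF.
exists T1, T0, f, (v \oc g), (h \oc u'); split=> // [|s].
  apply: (dist_iso (a := idm T1) (b := idm T0) (c := v)) d.
  - by exists (idm T1); rewrite comp1m.
  - by exists (idm T0); rewrite comp1m.
  - by exists u'.
  - by rewrite comp1m compm1.
  - by rewrite compm1.
  - by rewrite fmap1 comp1m -compA u'v compm1.
by rewrite -compA h0.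
Qed.

(** A module map out of Hom(T, X) = coker Hom(T, f) is a morphism out of T0
    vanishing on T1, and the weak cokernel property of the cone extends it. *)
Lemma add_resolution_lift (k : fieldType) (C : triangulated_category k)
    (T T1 T0 X Y : C) (f : T1 ~> T0) (g : T0 ~> X) (h : X ~> susp T1)
    (phi : {linear homfrom T X -> homfrom T Y}) :
  in_add T T1 -> in_add T T0 -> dist f g h ->
  (forall s : T ~> X, h \oc s = 0) ->
  exists u : X ~> Y, forall s : T ~> X, phi s = u \oc s.
Proof.
move=> addT1 addT0 d h0.
have [u uE] := add_hom_lift
  (phi \o (postcomp g : {linear homfrom T T0 -> homfrom T X})) addT0.
have [|c cg] := dist_extend (x := u) d.
  apply: (add_hom_eq0 addT1) => s.
  rewrite -compA -uE /= /postcomp compA (dist_comp0 d) comp0m.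
  exact: linear0.
exists c => s; have /dist_rot d1 := d.
have [s' ->] := dist_lift d1 (h0 s).
by rewrite compA -cg -uE.
Qed.

Lemma add_resolutions_full (k : fieldType) (C : triangulated_category k)
    (hf : hom_finite C) (ks : krull_schmidt C) (T : C) :
  (forall X : C, indecomposable X -> supported T X ->
     exists (T1 T0 : C) (f : T1 ~> T0) (g : T0 ~> X) (h : X ~> susp T1),
       [/\ in_add T T1, in_add T T0, dist f g h
         & forall s : T ~> X, h \oc s = 0]) ->
  full (hom_functor hf T).
Proof.
move=> resT; apply/hom_functor_fullP => X Y phi.
have [n [Z [locZ [inj [prj [_ _ e]]]]]] := ks X.
have lift_i i : exists u : Z i ~> Y, forall s : T ~> Z i,
    phi (inj i \oc s) = u \oc s.
  have [supZ|nsupZ] := pselect (supported T (Z i)).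
    have [T1 [T0 [f [g [h [addT1 addT0 d h0]]]]]] :=
      resT _ (local_indecomposable (locZ i)) supZ.
    exact: (add_resolution_lift
      (phi \o (postcomp (inj i) : {linear homfrom T (Z i) -> homfrom T X}))
      addT1 addT0 d h0).
  exists 0 => s; have -> : s = 0.
    by apply: contrapT => sN0; apply: nsupZ; exists s.
  by rewrite compm0 comp0m; apply: linear0.
pose u i := projT1 (cid (lift_i i)).
have uE i (s : T ~> Z i) : phi (inj i \oc s) = u i \oc s.
  by rewrite /u; case: cid.
exists (\sum_i u i \oc prj i) => s.
rewrite -[in LHS](comp1m s) -e !comp_suml [LHS]linear_sum.
by apply: eq_bigr => i _; rewrite -!compA uE.
Qed.

Theorem theorem1 (k : fieldType) (C : triangulated_category k)
    (hf : hom_finite C) (ks : krull_schmidt C) (T : C) :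
  quotient_functor (hom_functor hf T) <->
  (forall (T1 T0 : C) (f : T1 ~> T0),
     in_add T T1 -> in_add T T0 -> right_minimal f ->
     forall (X : C) (g : T0 ~> X) (h : X ~> susp T1), dist f g h ->
     forall s : T ~> X, h \oc s = 0)
  /\
  (forall X : C, indecomposable X -> supported T X ->
     exists (T1 T0 : C) (f : T1 ~> T0) (g : T0 ~> X) (h : X ~> susp T1),
       [/\ in_add T T1, in_add T T0, dist f g h
         & forall s : T ~> X, h \oc s = 0]).
Proof.
split=> [quotF|[vanish resT]].
  split=> [T1 T0 f addT1 addT0 minf X g h|X].
    exact: quotient_connecting_vanishes.
  exact: quotient_add_resolution.
split=> [|M]; first exact: add_resolutions_full.
have [T1 [T0 [f [p [addT1 addT0 minf psurj kerp]]]]] :=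
  right_minimal_presentation hf ks M (@tri_additive k C).
have [X [g [h d]]] := dist_cone f; exists X.
have h0 := vanish _ _ _ addT1 addT0 minf _ _ _ d.
exact: cone_realizes_cokernel psurj kerp d h0.
Qed.
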